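(* Let $k \geq 2$ be an integer. Let $q$ be a prime power such that $q \equiv 1 \pmod{k}$ if $q$ is even, or $q \equiv 1 \pmod{2k}$ if $q$ is odd. Let $\chi_k$ be a multiplicative character of $\mathbb{F}_q^*$ of order $k$. Then \[ \mathcal{K}_4(G_k(q)) = \frac{q^3(q-1)}{24 \cdot k^6} \sum_{\vec{t} \in (\mathbb{Z}_k)^5} {}_3F_2(\vec{t} \mid 1)_{q,k}. \]
   Context: For a graph $G$, $\mathcal{K}_m(G)$ denotes the number of complete subgraphs of order $m$ contained in $G$. For $k,q$ as in the claim, let $S_k$ be the subgroup of $\mathbb{F}_q^*$ of order $\frac{q-1}{k}$ consisting of the $k$-th power residues. The generalized Paley graph $G_k(q)$ is the graph with vertex set $\mathbb{F}_q$ in which $ab$ is an edge iff $a-b \in S_k$. Every multiplicative character $\chi$ of $\mathbb{F}_q^*$ (including the trivial character $\varepsilon$) is extended to $\mathbb{F}_q$ by $\chi(0)=0$; $\bar\chi$ is the inverse of $\chi$. For characters $A,B$, $J(A,B)=\sum_{a\in\mathbb{F}_q}A(a)B(1-a)$ and $\binom{A}{B} := \frac{B(-1)}{q}J(A,\bar B)$. Greene's hypergeometric function is \[ {}_{n+1}F_n\left(\begin{matrix}A_0,&A_1,&\dots,&A_n\\ &B_1,&\dots,&B_n\end{matrix}\Big|\,\lambda\right)_q := \frac{q}{q-1}\sum_{\chi}\binom{A_0\chi}{\chi}\binom{A_1\chi}{B_1\chi}\cdots\binom{A_n\chi}{B_n\chi}\chi(\lambda), \] the sum over all multiplicative characters $\chi$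 of $\mathbb{F}_q^*$. For $\vec t=(t_1,\dots,t_5)\in(\mathbb{Z}_k)^5$, ${}_3F_2(\vec t\mid\lambda)_{q,k}$ denotes ${}_3F_2\left(\begin{matrix}\chi_k^{t_1},&\chi_k^{t_2},&\chi_k^{t_3}\\ &\chi_k^{t_4},&\chi_k^{t_5}\end{matrix}\Big|\,\lambda\right)_q$. *)

(* Defs.v *)
From HB Require Import structures.
From mathcomp Require Import all_boot all_order all_fingroup all_algebra.
From mathcomp Require Import all_solvable all_field all_character.

Set Implicit Arguments.
Unset Strict Implicit.
Unset Printing Implicit Defensive.

Import GRing.Theory Num.Theory.

Local Open Scope ring_scope.

Section CompleteSubgraphs.
Variables (T : finType) (e : rel T).

Definition complete_in (A : {set T}) : bool :=
  [forall x in A, forall y in A, (x != y) ==> e x y].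

Definition num_complete (m : nat) : nat :=
  #|[set A : {set T} | (#|A| == m) && complete_in A]|.
End CompleteSubgraphs.

Definition power_residues (F : finFieldType) (k : nat) : {set {unit F}} :=
  [set (u ^+ k)%g | u in [set: {unit F}]].

Definition gen_paley (F : finFieldType) (k : nat) : rel F :=
  fun a b => [exists u in power_residues F k, a - b == val u].

(* Multiplicative characters of F are the linear characters of the finite     *)
(* group {unit F}; their values are roots of unity, hence lie in algC.  The   *)
(* constructions below are stated for arbitrary class functions but are only  *)
(* meant for linear characters, for which A^-1 is the inverse character.      *)
Section GreeneHypergeometric.
Variable F : finFieldType.
Local Notation U := [set: {unit F}]%G.
Local Notation q := #|F|.

Definition mchar_ext (A : 'CF(U)) (x : F) : algC :=
  if insub x is Some u then A u else 0.

Definition jacobi_sum (A B : 'CF(U)) : algC :=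
  \sum_(a : F) mchar_ext A a * mchar_ext B (1 - a).

Definition greene_binom (A B : 'CF(U)) : algC :=
  mchar_ext B (-1) / q%:R * jacobi_sum A B^-1.

(* 'A_0' is [A ord0], and 'A_(i+1)' is [A (lift ord0 i)], which is paired     *)
(* with the (i+1)-st lower parameter [B i].                                   *)
Definition greene_F (n : nat) (A : 'I_n.+1 -> 'CF(U)) (B : 'I_n -> 'CF(U))
    (lambda : F) : algC :=
  q%:R / (q%:R - 1) *
  \sum_(i : Iirr U | 'chi_i \is a linear_char)
     (greene_binom (A ord0 * 'chi_i) 'chi_i
      * (\prod_(j < n) greene_binom (A (lift ord0 j) * 'chi_i) (B j * 'chi_i))
      * mchar_ext 'chi_i lambda).

(* The first three coordinates of t are the upper exponents, the last two the *)
(* lower ones.  Since 'Z_k is only Z/kZ for k > 1, this assumes k > 1, and    *)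
(* exponents are the representatives in 0, ..., k - 1 (chi has order k).      *)
Definition greene_3F2 (k : nat) (chi : 'CF(U)) (t : {ffun 'I_5 -> 'Z_k})
    (lambda : F) : algC :=
  @greene_F 2 (fun i : 'I_3 => chi ^+ t (lshift 2 i))
              (fun j : 'I_2 => chi ^+ t (rshift 3 j)) lambda.
End GreeneHypergeometric.

(* Main.v *)
(** Let S be the group of k-th power residues; it contains -1.  Translating one
    vertex of an ordered 4-clique to 0 and scaling another to 1 shows that there
    are q |S| N of them, where |S| = (q - 1) / k and N counts the pairs (x, y) with
    x, y, 1 - x, 1 - y, x - y in S.

    On the other side, (A choose B) = q^-1 sum_a A(a) B(1/(a - 1)), so that 3F2 at 1
    is a sum over (a, b, c), and the inner sum over all characters forces
    abc = (a - 1)(b - 1)(c - 1).  Summing over the exponents t replaces the powers of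
    chi_k by k^5 times the indicator that a, b, c, b - 1, c - 1 lie in S.  The
    constraint determines a = (b - 1)(c - 1) / (1 - b - c), which lies in S exactly
    when 1 - b - c does; with x = b and y = 1 - c this is again the count N. *)

Require Import Defs.
From mathcomp Require Import all_boot all_order all_fingroup all_algebra.
From mathcomp Require Import all_solvable all_field all_character.
From mathcomp Require Import ring.

Set Implicit Arguments.
Unset Strict Implicit.
Unset Printing Implicit Defensive.

Import GRing.Theory Num.Theory.
Local Open Scope ring_scope.

(** * Cliques counted through ordered tuples *)

Lemma card_complete_tuples (T : finType) (e : rel T) (m : nat) :
  #|[set t : m.-tuple T | uniq t && complete_in e [set x in t]]| =
  (m`! * num_complete e m)%N.
Proof.
rewrite /num_complete -sum1_card.
rewrite (partition_big (fun t : m.-tuple T => [set x in t])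
  (fun A => A \in [set A : {set T} | (#|A| == m) && complete_in e A])) /=; last first.
  by move=> t; rewrite !inE => /andP[/card_uniqP + ->]; rewrite cardsE => ->;
    rewrite size_tuple eqxx.
rewrite (eq_bigr (fun=> m`!)) ?sum_nat_const 1?mulnC // => A.
rewrite inE => /andP[/eqP cA eA];
have -> : m`! = #|[pred x in A]| ^_ m by rewrite -ffactnn -{1}cA.
rewrite -card_uniq_tuples -sum1_card.
apply: eq_bigl => t; rewrite !inE andbC.
case Ut: (uniq t); rewrite ?andbF //= andbT.
apply/andP/allP => [[/eqP <- _ x]|sub]; first by rewrite /= inE.
have tA: [set x in t] = A.
  apply/eqP; rewrite eqEcard cA; apply/andP; split.
    by apply/subsetP => x; rewrite inE => /sub.
  by move/card_uniqP: Ut; rewrite cardsE => ->; rewrite size_tuple.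
by rewrite tA eqxx.
Qed.

(** The factor 24 is 4!. Irreflexivity makes adjacent vertices distinct, so the six edge conditions
    already imply [uniq]. The vertex [d] is outermost because it is the one later translated to
    0. *)
Lemma num_complete4E (T : finType) (e : rel T) :
  symmetric e -> irreflexive e ->
  (24 * num_complete e 4 = \sum_(d : T) \sum_(a : T) \sum_(b : T) \sum_(c : T)
     [&& e a d, e b d, e c d, e a b, e a c & e b c])%N.
Proof.
move=> sym irr; rewrite -(card_complete_tuples e 4).
rewrite cardsE -sum1_card.
rewrite (reindex (fun p : T * (T * (T * T)) =>
  [tuple p.2.1; p.2.2.1; p.2.2.2; p.1])) /=; last first.
  exists (fun t : 4.-tuple T => (tnth t (inord 3),
    (tnth t (inord 0), (tnth t (inord 1), tnth t (inord 2))))) => [[d [a [b c]]] _|t _].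
    by rewrite !(tnth_nth a) /= !inordK.
  by case: t => -[|a [|b [|c [|d []]]]] // ?; apply/val_inj;
    rewrite /= !(tnth_nth a) /= !inordK.
rewrite big_mkcond -(pair_bigA _ (fun d (p : T * (T * T)) =>
  if [tuple p.1; p.2.1; p.2.2; d] \in _ then 1%N else 0%N)) /=.
apply: eq_bigr => d _; rewrite -(pair_bigA _ (fun a (p : T * T) =>
  if [tuple a; p.1; p.2; d] \in _ then 1%N else 0%N)) /=.
apply: eq_bigr => a _; rewrite -(pair_bigA _ (fun b c : T =>
  if [tuple a; b; c; d] \in _ then 1%N else 0%N)) /=.
apply: eq_bigr => b _; apply: eq_bigr => c _.
rewrite unfold_in /= !inE !negb_or !andbT -[RHS]/(if _ then 1%N else 0%N).
congr (if _ then _ else _).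
have neq x y : e x y -> x != y by apply: contraTneq => ->; rewrite irr.
apply/idP/idP.
  case/andP=> /and3P[/and3P[ab ac ad] /andP[bc bd] cd] /forall_inP ce.
  have E x y : x \in [:: a; b; c; d] -> y \in [:: a; b; c; d] -> x != y -> e x y.
    move=> xA yA; have := ce x; rewrite inE => /(_ xA)/forall_inP/(_ y).
    by rewrite inE => /(_ yA)/implyP.
  by rewrite !E ?inE ?eqxx ?orbT.
case/and5P=> ad bd cd ab /andP[ac bc]; rewrite !neq //=.
apply/forall_inP => x; rewrite !inE => xA; apply/forall_inP => y.
rewrite !inE => yA; apply/implyP.
by case/or4P: xA => /eqP->; case/or4P: yA => /eqP->; rewrite ?eqxx // sym.
Qed.

(** * Power residues and the cliques of the Paley graph *)

Definition is_residue (F : finFieldType) (k : nat) (x : F) : bool :=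
  [exists u in power_residues F k, x == val u].

Lemma unit_val (F : finFieldType) (x : F) : x != 0 -> {u : {unit F} | x = val u}.
Proof.
by rewrite -unitfE => xU; exists (Sub x xU); rewrite SubK.
Qed.

Lemma is_residueP (F : finFieldType) (k : nat) (x : F) :
  reflect (exists2 v : F, v != 0 & x = v ^+ k) (is_residue k x).
Proof.
apply: (iffP exists_inP) => [[_ /imsetP[u _ ->] /eqP->]|[v v0 ->]].
  by exists (val u); rewrite ?FinRing.val_unitX // -unitfE (valP u).
have [u ->] := unit_val v0.
by exists (u ^+ k)%g; rewrite ?FinRing.val_unitX //; apply: imset_f; rewrite inE.
Qed.

Section Residues.
Variables (F : finFieldType) (k : nat).
Local Notation S := (@is_residue F k).

Lemma gen_paleyE (a b : F) : gen_paley k a b = S (a - b).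
Proof. by []. Qed.

Lemma is_residue0 : S 0 = false.
Proof.
by apply/is_residueP => -[v v0 /esym/eqP]; rewrite expf_eq0 (negPf v0) andbF.
Qed.

Lemma is_residue_neq0 (x : F) : S x -> x != 0.
Proof. by apply: contraTneq => ->; rewrite is_residue0. Qed.

Lemma is_residueM (x y : F) : S x -> S y -> S (x * y).
Proof.
move=> /is_residueP[u u0 ->] /is_residueP[v v0 ->].
by apply/is_residueP; exists (u * v); rewrite ?mulf_neq0 ?exprMn.
Qed.

Lemma is_residueV (x : F) : S x^-1 = S x.
Proof.
suff imp y : S y -> S y^-1 by apply/idP/idP => /imp; rewrite ?invrK.
by case/is_residueP=> v v0 ->; apply/is_residueP; exists v^-1; rewrite ?invr_eq0 ?exprVn.
Qed.

Lemma is_residueMl (x y : F) : S x -> S (x * y) = S y.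
Proof.
move=> Sx; apply/idP/idP => [|/(is_residueM Sx)//].
move: (Sx); rewrite -is_residueV => /is_residueM/[apply].
by rewrite mulKf // is_residue_neq0.
Qed.

(** The four vertices are written [d], [s + d], [s * x + d], [s * y + d] with [s] in S. Every
    difference not involving [d] is [s] times a difference of 1, [x], [y], and a factor in S does
    not affect membership in S. *)
Lemma num_complete4_gen_paley (SN1 : S (-1)) :
  (24 * num_complete (@gen_paley F k) 4 =
   #|F| * (\sum_(s | S s) 1) *
   \sum_(x : F) \sum_(y : F) [&& S x, S y, S (1 - x)%R, S (1 - y)%R & S (x - y)%R])%N.
Proof.
have SN x : S (- x) = S x by rewrite -mulN1r is_residueMl.
have sym : symmetric (@gen_paley F k).
  by move=> x y; rewrite !gen_paleyE -SN opprB.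
have irr : irreflexive (@gen_paley F k).
  by move=> x; rewrite gen_paleyE subrr is_residue0.
rewrite num_complete4E // -mulnA -sum_nat_const; apply: eq_bigr => d _.
rewrite big_distrl [RHS]big_mkcond /= (reindex_inj (addIr d)) /=.
apply: eq_bigr => s _; rewrite mul1n.
have [Ss|nSs] := boolP (S s); last first.
  by rewrite big1 // => b _; rewrite big1 // => c _;
    rewrite gen_paleyE addrK (negPf nSs).
have affine_inj : injective (fun x => s * x + d).
  by move=> x y /addIr/mulfI; apply; apply: is_residue_neq0.
rewrite (reindex_inj affine_inj); apply: eq_bigr => x _.
rewrite (reindex_inj affine_inj); apply: eq_bigr => y _; congr (nat_of_bool _).
have dif (u v : F) : (u + d) - (v + d) = u - v by ring.
rewrite !gen_paleyE !addrK !dif Ss /=.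
have fac (u : F) : s - s * u = s * (1 - u) by ring.
by rewrite !fac -mulrBr !is_residueMl.
Qed.

End Residues.

(** * Multiplicative characters extended by zero *)

Section Characters.
Variable F : finFieldType.
Local Notation U := [set: {unit F}]%G.
Local Notation ext := (@mchar_ext F).

Lemma mchar_ext_unit (A : 'CF(U)) (u : {unit F}) : ext A (val u) = A u.
Proof. by rewrite /mchar_ext valK. Qed.

Lemma mchar_ext0 (A : 'CF(U)) : ext A 0 = 0.
Proof. by rewrite /mchar_ext insubF // unitr0. Qed.

Lemma mchar_ext_cfM (A B : 'CF(U)) (x : F) : ext (A * B) x = ext A x * ext B x.
Proof.
have [->|/unit_val[u ->]] := eqVneq x 0; first by rewrite !mchar_ext0 mul0r.
by rewrite !mchar_ext_unit cfunE.
Qed.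

Lemma mchar_extM (A : 'CF(U)) (x y : F) :
  A \is a linear_char -> ext A (x * y) = ext A x * ext A y.
Proof.
move=> lA; have [->|/unit_val[u ->]] := eqVneq x 0.
  by rewrite mul0r !mchar_ext0 mul0r.
have [->|/unit_val[v ->]] := eqVneq y 0; first by rewrite mulr0 !mchar_ext0 mulr0.
by rewrite -FinRing.val_unitM !mchar_ext_unit lin_charM ?inE.
Qed.

Lemma mchar_ext1 (A : 'CF(U)) : A \is a linear_char -> ext A 1 = 1.
Proof. by move=> lA; rewrite -(FinRing.val_unit1 F) mchar_ext_unit lin_char1. Qed.

Lemma mchar_ext_cfV (A : 'CF(U)) (x : F) :
  A \is a linear_char -> ext A^-1 x = ext A x^-1.
Proof.
move=> lA; have [->|/unit_val[u ->]] := eqVneq x 0.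
  by rewrite invr0 !mchar_ext0.
rewrite -FinRing.val_unitV !mchar_ext_unit invr_lin_char //.
by rewrite cfunE lin_charV_conj ?inE.
Qed.

(** B(-1) is absorbed into the inverse character: B(-1) B(1/(1 - a)) = B(1/(a - 1)). At a = 1 both
    sides vanish, since 0^-1 = 0 and the extension is 0 there. *)
Lemma greene_binomE (A B : 'CF(U)) :
  B \is a linear_char ->
  greene_binom A B = #|F|%:R^-1 * \sum_(a : F) ext A a * ext B (a - 1)^-1.
Proof.
move=> lB; rewrite /greene_binom /jacobi_sum [ext B _ / _]mulrC -mulrA; congr (_ * _).
rewrite mulr_sumr; apply: eq_bigr => a _.
rewrite mchar_ext_cfV // mulrCA -mchar_extM //; congr (_ * ext B _).
by rewrite -(opprB a) invrN mulrN mulN1r opprK.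
Qed.

Lemma sum_mchar_ext (x : F) :
  \sum_(i : Iirr U | 'chi_i \is a linear_char) ext 'chi_i x =
  (#|F|.-1)%:R *+ (x == 1).
Proof.
have cU : cyclic U by apply: field_unit_group_cyclic.
have abU : abelian U by apply: cyclic_abelian.
have /char_abelianP lin := abU.
rewrite (eq_bigl xpredT) //.
have [->|/unit_val[u ->]] := eqVneq x 0.
  by rewrite eq_sym oner_eq0 mulr0n big1 // => i _; rewrite mchar_ext0.
rewrite -(FinRing.val_unit1 F) (inj_eq val_inj).
(* Column orthogonality for [u] and 1. The group is abelian, so the centralizer whose order appears
   is the whole unit group, of order q - 1. *)
transitivity (\sum_(i : Iirr U) 'chi_i u * ('chi_i 1%g)^*).
  by apply: eq_bigr => i _; rewrite mchar_ext_unit lin_char1 // rmorph1 mulr1.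
rewrite second_orthogonality_relation ?inE // class1G inE; congr (_%:R *+ _).
rewrite -card_finField_unit; congr #|pred_of_set _|; apply/setIidPl.
by rewrite sub_cent1 (subsetP abU) ?inE.
Qed.

End Characters.

(** * A character of order k and its kernel *)

Section CharacterOfOrderK.
Variables (F : finFieldType) (k : nat).
Local Notation U := [set: {unit F}]%G.
Local Notation ext := (@mchar_ext F).
Local Notation S := (@is_residue F k).
Hypothesis (k_dvd : (k %| #|F|.-1)%N).

Lemma unit_generator : exists2 g : {unit F}, [set: {unit F}] = <[g]>%g & #[g]%g = #|F|.-1.
Proof.
have /cyclicP[g Ug] := field_unit_group_cyclic U.
by exists g => //; rewrite orderE -Ug card_finField_unit.
Qed.

Lemma is_residue_cycle (g u : {unit F}) :
  [set: {unit F}] = <[g]>%g -> S (val u) = (u \in <[g ^+ k]>%g).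
Proof.
move=> Ug; apply/exists_inP/cycleP => [[_ /imsetP[v _ ->] /eqP/val_inj->]|[m ->]].
  have /cycleP[m ->] : v \in <[g]>%g by rewrite -Ug inE.
  by exists m; rewrite expgAC.
by exists ((g ^+ k) ^+ m)%g; rewrite // expgAC; apply: imset_f; rewrite inE.
Qed.

Lemma sum_is_residue : (k * (\sum_(x | S x) 1) = #|F|.-1)%N.
Proof.
have [g Ug og] := unit_generator.
have -> : (\sum_(x | S x) 1 = #|<[g ^+ k]>%g|)%N.
  rewrite sum1_card -(card_imset _ val_inj); apply: eq_card => x.
  rewrite [LHS]unfold_in; apply/idP/imsetP => [Sx|[u + ->]].
    have [u xu] := unit_val (is_residue_neq0 Sx); exists u => //.
    by rewrite -(is_residue_cycle _ Ug) -xu.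
  by rewrite -is_residue_cycle.
by rewrite -orderE orderXdiv og // mulnC divnK.
Qed.

(** With -1 = g^m for a generator g, q - 1 divides 2m. For odd q, 2k divides q - 1, hence k divides
    m. For even q, k divides the odd number q - 1, so k is coprime to 2 and again divides m. *)
Lemma is_residueN1 (q := #|F|)
    (hq : if odd q then q = 1 %[mod 2 * k] else q = 1 %[mod k]) :
  S (-1).
Proof.
have [g Ug og] := unit_generator.
have N1_neq0 : -1 != 0 :> F by rewrite oppr_eq0 oner_eq0.
have [u uN1] := unit_val N1_neq0.
have /cycleP[m um] : u \in <[g]>%g by rewrite -Ug inE.
have u2 : (u ^+ 2 = 1)%g.
  by apply: val_inj; rewrite FinRing.val_unitX -uN1 sqrrN expr1n.
have k_dvd_m : (k %| m)%N.
  have : (q.-1 %| m * 2)%N by rewrite -og order_dvdn expgM -um u2.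
  have q_gt0 : (0 < q)%N by apply/card_gt0P; exists 0.
  move: hq k_dvd; rewrite -/q; case oq: (odd q) => /eqP; rewrite eqn_mod_dvd // subn1.
    by move=> kq _ /(dvdn_trans kq); rewrite mulnC dvdn_pmul2r.
  move=> kq _ /(dvdn_trans kq); rewrite Gauss_dvdl // coprimen2.
  by apply: dvdn_odd kq _; rewrite -subn1 oddB // oq.
have [j mj] := dvdnP k_dvd_m.
apply/is_residueP; exists (val (g ^+ j)%g).
  by rewrite -unitfE (valP (g ^+ j)%g).
by rewrite uN1 um mj -FinRing.val_unitX -expgM.
Qed.

Variable chi : 'CF(U).
Hypotheses (chi_lin : chi \is a linear_char) (chi_order : #[chi]%CF = k).

(** A character is determined by its value at a generator g, so chi(g) has order exactly k. Thus
    chi(g^m) = 1 iff k divides m, that is, iff g^m lies in the group generated by g^k. *)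
Lemma order_char_eq1 (u : {unit F}) : (chi u == 1) = S (val u).
Proof.
have [g Ug og] := unit_generator.
rewrite (is_residue_cycle _ Ug).
have /cycleP[m um] : u \in <[g]>%g by rewrite -Ug inE.
have dvd_k n : (k %| n)%N = (chi (g ^+ n)%g == 1).
  rewrite -chi_order dvdn_cforder lin_charX ?inE // -exp_cfunE ?inE //.
  apply/eqP/eqP => [->|gn1]; first by rewrite cfun1E inE.
  apply/cfun_inP => v Uv; rewrite cfun1E Uv.
  have /cycleP[j ->] : v \in <[g]>%g by rewrite -Ug inE.
  by rewrite lin_charX ?inE ?rpredX // gn1 expr1n.
rewrite um -dvd_k; apply/dvdnP/cycleP => -[j].
  by move=> ->; exists j; rewrite mulnC expgM.
(* The exponents agree only modulo q - 1; since k divides q - 1, they also agree modulo k. *)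
rewrite -expgM => /eqP; rewrite eq_expg_mod_order og => /eqP mj.
apply/dvdnP; rewrite /dvdn -(modn_dvdm m k_dvd) mj.
by rewrite modn_dvdm // modnMr.
Qed.

Lemma sum_char_powers (x : F) :
  \sum_(i < k) ext (chi ^+ i) x = k%:R *+ S x.
Proof.
have [->|/unit_val[u ->]] := eqVneq x 0.
  by rewrite is_residue0 big1 // => i _; rewrite mchar_ext0.
rewrite (eq_bigr (fun i : 'I_k => chi u ^+ i)); last first.
  by move=> i _; rewrite mchar_ext_unit exp_cfunE ?inE.
rewrite -order_char_eq1; have [->|nu1] := eqVneq (chi u) 1.
  by rewrite (eq_bigr (fun=> 1)) ?sumr_const ?card_ord // => i _; rewrite expr1n.
(* Outside S, [chi u] is a k-th root of unity other than 1, so its geometric sum vanishes. *)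
have /eqP : chi u ^+ k - 1 = 0.
  by rewrite -exp_cfunE ?inE // -chi_order exp_cforder cfun1E inE subrr.
by rewrite subrX1 mulf_eq0 subr_eq0 (negPf nu1) => /eqP.
Qed.
End CharacterOfOrderK.

(** * Evaluation of the sum of the 3F2 values *)

Section SumOfGreene.
Variables (F : finFieldType) (k : nat).
Local Notation U := [set: {unit F}]%G.
Local Notation ext := (@mchar_ext F).
Local Notation S := (@is_residue F k).
Local Notation q := #|F|.

(** Isolates [phi] at a single argument, so that the sum over all characters can later be carried
    out by orthogonality. *)
Lemma greene_binom_twist (A B phi : 'CF(U)) :
  B \is a linear_char -> phi \is a linear_char ->
  greene_binom (A * phi) (B * phi) =
  q%:R^-1 * \sum_(a : F) ext A a * ext B (a - 1)^-1 * ext phi (a / (a - 1)).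
Proof.
move=> lB lphi; rewrite greene_binomE ?rpredM //; congr (_ * _).
by apply: eq_bigr => a _; rewrite !mchar_ext_cfM mchar_extM // mulrACA.
Qed.

Lemma greene_binom_twist1 (A phi : 'CF(U)) :
  phi \is a linear_char ->
  greene_binom (A * phi) phi =
  q%:R^-1 * \sum_(a : F) ext A a * ext phi (a / (a - 1)).
Proof.
move=> lphi; rewrite greene_binomE //; congr (_ * _).
by apply: eq_bigr => a _; rewrite mchar_ext_cfM mchar_extM // mulrA.
Qed.

(* The arguments at which the powers chi ^+ t j are evaluated in 3F2(t | 1). *)
Definition greene_pt (a b c : F) (j : nat) : F :=
  nth 0 [:: a; b; c; (b - 1)^-1; (c - 1)^-1] j.

(** The argument of the summation character once the three binomials are multiplied out. It is 0 as
    soon as one of [a], [b], [c] is 0 or 1. *)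
Definition greene_arg (a b c : F) : F :=
  a / (a - 1) * (b / (b - 1)) * (c / (c - 1)).

(** The binomials contribute q^-3 and orthogonality a factor q - 1; with the prefactor q/(q - 1)
    this leaves q^-2. *)
Lemma greene_3F2_at1 (chi : 'CF(U)) (t : {ffun 'I_5 -> 'Z_k}) :
  chi \is a linear_char ->
  greene_3F2 chi t 1 =
  (q%:R ^+ 2)^-1 * \sum_(a : F) \sum_(b : F) \sum_(c : F)
     (greene_arg a b c == 1)%:R * \prod_(j < 5) ext (chi ^+ t j) (greene_pt a b c j).
Proof.
move=> lchi; rewrite /greene_3F2 /greene_F.
have q1 : (q%:R - 1 : algC) = q.-1%:R.
  by rewrite -(@prednK q) ?mulrSr ?addrK //; apply/card_gt0P; exists 0.
have q1_neq0 : q.-1%:R != 0 :> algC.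
  by rewrite pnatr_eq0 -lt0n -card_finField_unit cardG_gt0.
have q_neq0 : q%:R != 0 :> algC.
  by rewrite pnatr_eq0 -lt0n; apply/card_gt0P; exists 0.
pose P a b c : algC := \prod_(j < 5) ext (chi ^+ t j) (greene_pt a b c j).
have term (i : Iirr U) : 'chi_i \is a linear_char ->
  greene_binom (chi ^+ t (lshift 2 (ord0 : 'I_3)) * 'chi_i) 'chi_i *
  (\prod_(j < 2) greene_binom (chi ^+ t (lshift 2 (lift ord0 j : 'I_3)) * 'chi_i)
     (chi ^+ t (rshift 3 j) * 'chi_i)) * ext 'chi_i 1 =
  (q%:R ^+ 3)^-1 * \sum_(a : F) \sum_(b : F) \sum_(c : F)
    P a b c * ext 'chi_i (greene_arg a b c).
  move=> li; rewrite mchar_ext1 // mulr1 !big_ord_recl big_ord0 mulr1.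
  rewrite greene_binom_twist1 // !greene_binom_twist ?rpredX //.
  (* The five positions are put in the iterated [lift] form that [big_ord_recl] produces when [P] is
     unfolded. *)
  have -> : lshift 2 (ord0 : 'I_3) = ord0 by exact: val_inj.
  have -> : lshift 2 (lift ord0 ord0 : 'I_3) = lift ord0 ord0 by exact: val_inj.
  have -> : lshift 2 (lift ord0 (lift ord0 ord0) : 'I_3) = lift ord0 (lift ord0 ord0)
    by exact: val_inj.
  have -> : rshift 3 (ord0 : 'I_2) = lift ord0 (lift ord0 (lift ord0 ord0))
    by exact: val_inj.
  have -> : rshift 3 (lift ord0 ord0 : 'I_2) =
      lift ord0 (lift ord0 (lift ord0 (lift ord0 ord0))) by exact: val_inj.
  have merge (x y z : algC) : q%:R^-1 * x * (q%:R^-1 * y * (q%:R^-1 * z)) =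
      (q%:R ^+ 3)^-1 * (x * (y * z)) by field.
  rewrite merge; congr (_ * _); rewrite mulr_suml; apply: eq_bigr => a _.
  rewrite big_distrlr mulr_sumr; apply: eq_bigr => b _.
  rewrite mulr_sumr; apply: eq_bigr => c _.
  rewrite /P !big_ord_recl big_ord0 /greene_pt /greene_arg !mchar_extM //=.
  by ring.
rewrite (eq_bigr _ term) -mulr_sumr mulrA q1.
have -> : q%:R / q.-1%:R * (q%:R ^+ 3)^-1 = (q%:R ^+ 2)^-1 * q.-1%:R^-1 :> algC.
  by field; rewrite q_neq0 q1_neq0.
rewrite -mulrA; congr (_ * _); rewrite exchange_big mulr_sumr; apply: eq_bigr => a _.
rewrite exchange_big mulr_sumr; apply: eq_bigr => b _.
rewrite exchange_big mulr_sumr; apply: eq_bigr => c _.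
rewrite -mulr_sumr sum_mchar_ext -mulr_natr -/(P a b c).
by field.
Qed.

Lemma sum_greene_arg (b c : F) : S (-1) ->
  (\sum_(a : F) [&& greene_arg a b c == 1%R, S a, S b, S c, S (b - 1)^-1%R & S (c - 1)^-1%R]
   = [&& S b, S (1 - c)%R, S (1 - b)%R, S (1 - (1 - c))%R & S (b - (1 - c))%R])%N.
Proof.
move=> SN1; have SN x : S (- x) = S x by rewrite -mulN1r is_residueMl.
rewrite !is_residueV.
have -> : 1 - c = - (c - 1) by ring.
have -> : 1 - b = - (b - 1) by ring.
have -> : 1 - - (c - 1) = c by ring.
have -> : b - - (c - 1) = - (1 - b - c) by ring.
rewrite !SN.
have [Sb|_] := boolP (S b); last by rewrite big1 ?andbF //= => a _; rewrite ?andbF.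
have [Sc|_] := boolP (S c); last by rewrite big1 ?andbF //= => a _; rewrite ?andbF.
have [Sb1|_] := boolP (S (b - 1)); last by rewrite big1 ?andbF //= => a _; rewrite ?andbF.
have [Sc1|_] := boolP (S (c - 1)); last by rewrite big1 ?andbF //= => a _; rewrite ?andbF.
have /is_residue_neq0 b0 := Sb; have /is_residue_neq0 c0 := Sc.
have /is_residue_neq0 b1 := Sb1; have /is_residue_neq0 c1 := Sc1.
(* Clearing denominators, abc = (a - 1)(b - 1)(c - 1) is linear in a: a(1 - b - c) = (b - 1)(c -
   1). *)
pose a0 := (b - 1) * (c - 1) * (1 - b - c)^-1.
have arg_eq1 a : S a -> (greene_arg a b c == 1) = (a == a0).
  move=> Sa; have a_neq0 := is_residue_neq0 Sa.
  apply/eqP/eqP.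
    rewrite /greene_arg /a0 => e.
    have a1 : a - 1 != 0.
      by apply: contra_eq_neq e => ->; rewrite invr0 mulr0 !mul0r eq_sym oner_eq0.
    have e' : a * (1 - b - c) = (b - 1) * (c - 1).
      have -> : a * (1 - b - c) =
          (a - 1) * (b - 1) * (c - 1) + (b - 1) * (c - 1) - a * b * c by ring.
      have -> : a * b * c = (a - 1) * (b - 1) * (c - 1) *
        (a / (a - 1) * (b / (b - 1)) * (c / (c - 1))) by field; rewrite a1 b1 c1.
      by rewrite e; ring.
    have d0 : 1 - b - c != 0.
      by apply: contra_eq_neq e' => ->; rewrite mulr0 eq_sym !mulf_neq0.
    by rewrite -e' mulfK.
  (* If 1 - b - c were 0, the convention 0^-1 = 0 would give [a0 = 0], which is not in S. *)
  move=> aE; have d0 : 1 - b - c != 0.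
    by apply: contraTneq Sa => d0; rewrite aE /a0 d0 invr0 mulr0 is_residue0.
  have a1 : a - 1 = b * c / (1 - b - c) by rewrite aE /a0; field.
  rewrite /greene_arg a1 aE /a0; field.
  by rewrite b0 c0 b1 c1 d0.
rewrite (bigD1 a0) //= big1 => [|a na0].
  have Sa0 : S a0 = S (1 - b - c) by rewrite /a0 !is_residueMl // is_residueV.
  rewrite -Sa0; have [Sa|_] := boolP (S a0); last by rewrite andbF.
  by rewrite arg_eq1 // eqxx.
have [Sa|_] := boolP (S a); last by rewrite andbF.
by rewrite arg_eq1 // (negPf na0).
Qed.

Lemma sum_greene_3F2 (chi : 'CF(U)) :
  (1 < k)%N -> chi \is a linear_char -> #[chi]%CF = k -> S (-1) ->
  \sum_(t : {ffun 'I_5 -> 'Z_k}) greene_3F2 chi t 1 =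
  k%:R ^+ 5 / q%:R ^+ 2 *
  (\sum_(x : F) \sum_(y : F)
     [&& S x, S y, S (1 - x)%R, S (1 - y)%R & S (x - y)%R])%:R.
Proof.
move=> k1 lchi ochi SN1.
have k_dvd : (k %| q.-1)%N.
  by rewrite -ochi -card_finField_unit cforder_lin_char_dvdG.
have powers x : \sum_(s : 'Z_k) ext (chi ^+ s) x = k%:R * (S x)%:R.
  (* As 1 < k, the ordinal type underlying ['Z_k] has exactly k elements. *)
  rewrite -(big_mkord xpredT (fun s => ext (chi ^+ s) x)) Zp_cast // big_mkord.
  by rewrite (sum_char_powers k_dvd) // mulr_natr.
rewrite (eq_bigr _ (fun t _ => greene_3F2_at1 t lchi)) -mulr_sumr.
rewrite [k%:R ^+ 5 / _]mulrC -mulrA; congr (_ * _).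
have collapse a b c :
    \sum_(t : {ffun 'I_5 -> 'Z_k}) \prod_(j < 5) ext (chi ^+ t j) (greene_pt a b c j) =
    k%:R ^+ 5 * [&& S a, S b, S c, S (b - 1)^-1 & S (c - 1)^-1]%:R.
  (* The five exponents are independent, so the sum over [t] factors into five sums over ['Z_k]. *)
  rewrite -(bigA_distr_bigA (fun (j : 'I_5) (s : 'Z_k) =>
    ext (chi ^+ s) (greene_pt a b c j))) /=.
  rewrite (eq_bigr _ (fun j _ => powers _)) big_split /= prodr_const card_ord.
  by congr (_ * _); rewrite !big_ord_recl big_ord0 /= mulr1 -!natrM !mulnb.
rewrite exchange_big /=.
have swap a : \sum_(t : {ffun 'I_5 -> 'Z_k}) \sum_b \sum_c
      (greene_arg a b c == 1)%:R * \prod_(j < 5) ext (chi ^+ t j) (greene_pt a b c j) =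
    k%:R ^+ 5 * \sum_b \sum_c
      [&& greene_arg a b c == 1, S a, S b, S c, S (b - 1)^-1 & S (c - 1)^-1]%:R.
  rewrite exchange_big mulr_sumr; apply: eq_bigr => b _.
  rewrite exchange_big mulr_sumr; apply: eq_bigr => c _.
  by rewrite -mulr_sumr collapse mulrCA -natrM mulnb.
rewrite (eq_bigr _ (fun a _ => swap a)) -mulr_sumr; congr (_ * _).
rewrite exchange_big natr_sum; apply: eq_bigr => b _.
(* The substitution y = 1 - c matches the pairs (b, c) with the pairs (x, y). *)
rewrite exchange_big natr_sum (reindex_inj (inv_inj (subKr 1))) /=.
apply: eq_bigr => c _.
by rewrite -natr_sum sum_greene_arg // subKr.
Qed.

End SumOfGreene.

Theorem theorem2p1 (k : nat) (hk : (2 <= k)%N)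
    (q : nat) (F : finFieldType) (hF : #|F| = q)
    (hq : if odd q then q = 1 %[mod 2 * k] else q = 1 %[mod k])
    (chi : 'CF([set: {unit F}])) (hchi : chi \is a linear_char)
    (hord : #[chi]%CF = k) :
  (num_complete (@gen_paley F k) 4)%:R =
    (q%:R ^+ 3 * (q%:R - 1)) / (24%:R * k%:R ^+ 6)
    * \sum_(t : {ffun 'I_5 -> 'Z_k}) greene_3F2 chi t 1 :> algC.
Proof.
have k_dvd : (k %| #|F|.-1)%N.
  by rewrite -hord -card_finField_unit cforder_lin_char_dvdG.
move: hq; rewrite -{q}hF => hq; have SN1 := is_residueN1 k_dvd hq.
rewrite sum_greene_3F2 //; set N := (\sum_x _)%N.
have q_gt0 : (0 < #|F|)%N by apply/card_gt0P; exists 0.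
have q_neq0 : #|F|%:R != 0 :> algC by rewrite pnatr_eq0 -lt0n.
have k_neq0 : k%:R != 0 :> algC by rewrite pnatr_eq0 -lt0n ltnW.
have := congr1 (fun n => n%:R : algC) (num_complete4_gen_paley SN1).
have := congr1 (fun n => n%:R : algC) (sum_is_residue k_dvd).
(* With s = |S|, q - 1 becomes k s, and the claim reduces to 24 times the clique number being q s
   N. *)
rewrite -/N -subn1 natrB // !natrM => <-; set s := (\sum_(x | _) _)%N%:R => cliques.
rewrite -[LHS](mulKf (x := 24%:R)) ?pnatr_eq0 // cliques.
by field; rewrite k_neq0 q_neq0.
Qed.
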